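(* Let $\mathcal{X}$ have a hierarchical partitioning $\mathcal{P}$ of branching factor $K\ge2$, let $\nu>0$, $\rho\in(0,1)$, $d\in[0,d_{\max}]$ with $d_{\max}=\frac{\log K}{\log(1/\rho)}$, $C\ge C_{\min}=(K\rho^d)^{\lfloor\log3/\log(1/\rho)\rfloor}$, and let $\mathrm{Asm}$ be one of Assumptions (a), (b), (c) with its parameters. Then for any budget $\Lambda\ge1$, any target function $f\in S(\mathcal{P},\nu,\rho,d,C)$, any cost function $\lambda$ and any fidelity approximations $(f_z)_{z\in Z}\in F(\mathrm{Asm},f,\lambda)$ given to Kometo, the simple regret $r_\Lambda$ of Kometo satisfies the following, where $L=\log(1/\rho)$, $W$ is the Lambert function (inverse of $w\mapsto we^w$ on $[0,\infty)$), and $\tilde\Lambda=\left\lfloor\frac{(e-1)\Lambda}{2Ke(\log\Lambda+1)^2}\right\rfloor$. Under Assumption (a) ($\Phi(c)\le A/c^\alpha$): let $h_1=\frac{1}{(d+1/\alpha)L}W\!\left(\frac{\tilde\Lambda\,\nu^{1/\alpha}(d+1/\alpha)L}{4CeA^{1/\alpha}}\right)$, and $h_2=\frac{\tilde\Lambda}{4C}$ if $d=0$, $h_2=\frac{1}{dL}W\!\left(\frac{\tilde\Lambda dL}{4C}\right)$ if $d>0$. If $\nu\rho^{h_1}\le e^\alpha A$ (high budget) then $r_\Lambda\le\frac{3\nu}{\rho}\rho^{h_1}+\frac{2A}{\tilde\Lambda^\alpha}$; if $\nu\rho^{h_1}>e^\alpha A$ (low budget) then $r_\Lambda\le\frac{3\nu}{\rho}\rho^{h_2}+\frac{2A}{\tilde\Lambda^\alpha}$.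 Under Assumption (b) ($\Phi(c)\le Be^{-c^\beta/\sigma}$): let $a_{b,\nu}=\max\left(\frac{1}{2\sigma},\log\frac{B}{\nu}\right)$; let $h_1=\left(\frac{\tilde\Lambda}{4Ce}\right)^{\frac{\beta}{\beta+1}}\left(\frac{1}{2\sigma L}\right)^{\frac{1}{\beta+1}}$ if $d=0$ and $h_1=\frac{\beta+1}{\beta dL}W\!\left(\frac{\beta}{\beta+1}dL\left(\frac{\tilde\Lambda}{4Ce}\right)^{\frac{\beta}{\beta+1}}\left(\frac{1}{2\sigma L}\right)^{\frac{1}{\beta+1}}\right)$ if $d>0$; let $h_2=\frac{\tilde\Lambda}{4Ce(2\sigma a_{b,\nu})^{1/\beta}}$ if $d=0$ and $h_2=\frac{1}{dL}W\!\left(\frac{\tilde\Lambda dL}{4Ce(2\sigma a_{b,\nu})^{1/\beta}}\right)$ if $d>0$. If $h_1\ge a_{b,\nu}/L$ (high budget) then $r_\Lambda\le\frac{3\nu}{\rho}\rho^{h_1}+2Be^{-\tilde\Lambda^\beta/\sigma}$; if $h_1<a_{b,\nu}/L$ (low budget) then $r_\Lambda\le\frac{3\nu}{\rho}\rho^{h_2}+2Be^{-\tilde\Lambda^\beta/\sigma}$. Under Assumption (c) ($\Phi(c)=0$ for $c\ge a$): let $h=\frac{\tilde\Lambda}{4Cae}$ if $d=0$ and $h=\frac{1}{dL}W\!\left(\frac{\tilde\Lambda dL}{4Cae}\right)$ if $d>0$. Then $r_\Lambda\le\frac{\nu}{\rho}\rho^{h}$.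
   Context: Hierarchical partitioning: $\mathcal{P}=(\mathcal{P}_{h,i})_{h\ge0,0\le i\le K^h-1}$, $\mathcal{P}_{0,0}=\mathcal{X}$, the children $\mathcal{P}_{h+1,Ki+l}$ ($0\le l\le K-1$) of $\mathcal{P}_{h,i}$ partition it; each cell has a fixed representative $x_{h,i}\in\mathcal{P}_{h,i}$. Smoothness: $f:\mathcal{X}\to\mathbb{R}$ has smoothness parameters $(\nu,\rho)$ if for one global maximizer $x^\star$ and all $h\ge0$, every $x$ in the depth-$h$ cell containing $x^\star$ satisfies $f(x)\ge f(x^\star)-\nu\rho^h$. $N_h(\epsilon)$ is the number of depth-$h$ cells with $\sup_{x\in\mathcal{P}_{h,i}}f(x)\ge f(x^\star)-\epsilon$. $d\ge0$ is a near-optimality dimension with constant $C>1$ if $N_h(3\nu\rho^h)\le C\rho^{-dh}$ for all $h$. $S(\mathcal{P},\nu,\rho,d,C)$ is the set of such $f$. Multi-fidelity: $Z=[0,1]$, $f_z:\mathcal{X}\to\mathbb{R}$; bias $\zeta:Z\to[0,+\infty]$ with strictly increasing $g_z$ such that $\sup_x|f(x)-g_z(f_z(x))|\le\zeta(z)$; cost $\lambda:Z\to[0,+\infty]$; for $c\ge1$ a fidelity $z_c$ with $\lambda(z_c)\le c$ is available; cost-to-bias function $\Phi(c)=\zeta(z_c)$. Assumption (a): $\Phi(c)\le A/c^\alpha$ for some $A,\alpha>0$; (b): $\Phi(c)\le Be^{-c^\beta/\sigma}$ for some $B,\sigma,\beta>0$; (c): $\Phi(c)=0$ for all $c\ge a$,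 for some $a\ge1$. $F(\mathrm{Asm},f,\lambda)$ is the set of families $(f_z)$ for which some bias function $\zeta$ makes $\mathrm{Asm}$ hold with cost $\lambda$. Simple regret $r_\Lambda=\mathbb{E}[\max_x f(x)-f(x_\Lambda)]$ with $x_\Lambda$ the output. Kometo (log is natural log): $j_{\max}=\lfloor\log\tilde\Lambda\rfloor$. Fidelity level $j$ means fidelity $z_{e^j}$. Flags $T_{h,i,j}\in\{0,1\}$ (initially 0) and values $f_{h,i,j}=f_{z_{e^j}}(x_{h,i})$ when $T_{h,i,j}=1$. Opening $\mathcal{P}_{h,i}$ at level $j$: for each child $\mathcal{P}_{h+1,i'}$ and $0\le u\le j$ set $T_{h+1,i',u}=1$ and evaluate $f_{h+1,i',u}$. Steps: (1) open $\mathcal{P}_{0,0}$ with budget $\tilde\Lambda$ (at level $j_{\max}$); (2) for $h=1..\lfloor\tilde\Lambda\rfloor$, for $m=1..\lfloor\tilde\Lambda/h\rfloor$: $j=\lfloor\log\frac{\tilde\Lambda}{hm}\rfloor$, open at level $j$ the not-yet-opened depth-$h$ cell with $T_{h,i,j}=1$ and highest $f_{h,i,j}$; (3) for $j=0..j_{\max}$, let $x^c_j$ be the representative of a cell maximizing $f_{h,i,j}$ among $T_{h,i,j}=1$, and evaluate $f_{z_{\tilde\Lambda}}(x^c_j)$; (4) output $x_\Lambda=\arg\max_j f_{z_{\tilde\Lambda}}(x^c_j)$. *)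

(* Defs.v *)
From HB Require Import structures.
From mathcomp Require Import all_boot all_order all_algebra.
From mathcomp Require Import all_classical all_reals all_analysis.
Set Implicit Arguments. Unset Strict Implicit. Unset Printing Implicit Defensive.
Import Order.TTheory GRing.Theory Num.Theory.
Local Open Scope classical_set_scope.
Local Open Scope ring_scope.

Section Defs.
Variable R : realType.

(* Lambert function on [0,+oo): the unique y >= 0 with y e^y = w (0 elsewhere). *)
Definition LambertW (w : R) : R :=
  xget 0 [set y : R | 0 <= y /\ y * expR y = w].

Definition hier_partition (X : Type) (K : nat) (P : nat -> nat -> set X)
  (xr : nat -> nat -> X) : Prop :=
  [/\ P 0%N 0%N = setT,
      (forall h i, (i < K ^ h)%N ->
         P h i = \bigcup_(l in [set l : nat | (l < K)%N]) P h.+1 (K * i + l)%N),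
      (forall h i l l', (i < K ^ h)%N -> (l < K)%N -> (l' < K)%N -> l <> l' ->
         P h.+1 (K * i + l)%N `&` P h.+1 (K * i + l')%N = set0)
    & (forall h i, (i < K ^ h)%N -> P h i (xr h i))].

Definition fmax (X : Type) (f : X -> R) : R := sup (range f).

Definition smooth (X : Type) (K : nat) (P : nat -> nat -> set X) (nu rho : R)
  (f : X -> R) : Prop :=
  exists xstar : X, (forall x, f x <= f xstar) /\
    forall h i, (i < K ^ h)%N -> P h i xstar ->
      forall x, P h i x -> f xstar - nu * rho ^+ h <= f x.

Definition Nh (X : Type) (K : nat) (P : nat -> nat -> set X) (f : X -> R)
  (h : nat) (eps : R) : nat :=
  count (fun i => `[< (ereal_sup [set (f x)%:E | x in P h i] >=
                       (fmax f - eps)%:E)%E >]) (iota 0 (K ^ h)).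

Definition in_S (X : Type) (K : nat) (P : nat -> nat -> set X)
  (nu rho d C : R) (f : X -> R) : Prop :=
  smooth K P nu rho f /\ 0 <= d /\ 1 < C /\
  forall h : nat, (Nh K P f h (3 * nu * rho ^+ h))%:R <= C * rho `^ (- (d * h%:R)).

Definition asm_a (A alpha : R) (Phi : R -> \bar R) : Prop :=
  forall c, 1 <= c -> (Phi c <= (A / c `^ alpha)%:E)%E.
Definition asm_b (B sigma beta : R) (Phi : R -> \bar R) : Prop :=
  forall c, 1 <= c -> (Phi c <= (B * expR (- (c `^ beta) / sigma))%:E)%E.
Definition asm_c (a : R) (Phi : R -> \bar R) : Prop :=
  forall c, 1 <= c -> a <= c -> Phi c = 0%E.

(* Fidelity space Z = [0,1]; z_c = zsel c is the available fidelity of cost <= c. *)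
Definition fidelity_avail (lam : R -> \bar R) (zsel : R -> R) : Prop :=
  forall c, 1 <= c -> 0 <= zsel c <= 1 /\ (lam (zsel c) <= c%:E)%E.

Definition in_F (X : Type) (Asm : (R -> \bar R) -> Prop) (f : X -> R)
  (lam : R -> \bar R) (zsel : R -> R) (fz : R -> X -> R) : Prop :=
  fidelity_avail lam zsel /\
  exists (zeta : R -> \bar R) (g : R -> R -> R),
    [/\ (forall z, 0 <= z <= 1 -> (0 <= zeta z)%E),
        (forall z, 0 <= z <= 1 -> {homo g z : a b / a < b}),
        (forall z, 0 <= z <= 1 -> forall x, (`|f x - g z (fz z x)|%:E <= zeta z)%E)
      & Asm (fun c => zeta (zsel c))].

Definition argmax_spec (T : eqType) (ch : seq T -> (T -> R) -> T) : Prop :=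
  forall s g, s != [::] -> ch s g \in s /\ forall y, y \in s -> g y <= g (ch s g).

Section Kometo.
Variables (X : Type) (K : nat) (xr : nat -> nat -> X) (fz : R -> X -> R)
  (zsel : R -> R) (Lt : nat)
  (ch1 : seq (nat * nat) -> (nat * nat -> R) -> nat * nat)
  (ch2 : seq nat -> (nat -> R) -> nat).

Definition jmax : nat := Num.truncn (ln (Lt%:R : R)).

Definition fval (c : nat * nat) (j : nat) : R := fz (zsel (expR j%:R)) (xr c.1 c.2).

(* state: flagged triples ((h,i),u) with T_{h,i,u}=1, and opened cells (h,i) *)
Definition kstate := (seq ((nat * nat) * nat) * seq (nat * nat))%type.

Definition open_cell (st : kstate) (c : nat * nat) (j : nat) : kstate :=
  ([seq ((c.1.+1, K * c.2 + l)%N, u) | l <- iota 0 K, u <- iota 0 j.+1] ++ st.1,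
   c :: st.2).

Definition step1 : kstate := open_cell ([::], [::]) (0%N, 0%N) jmax.

Definition level (h m : nat) : nat := Num.truncn (ln (Lt%:R / (h * m)%:R : R)).

Definition candidates (st : kstate) (h j : nat) : seq (nat * nat) :=
  undup [seq t.1 | t <- st.1 & [&& t.1.1 == h, t.2 == j & t.1 \notin st.2]].

Definition step2_one (st : kstate) (hm : nat * nat) : kstate :=
  let j := level hm.1 hm.2 in
  let cs := candidates st hm.1 j in
  if cs is [::] then st else open_cell st (ch1 cs (fun c => fval c j)) j.

Definition schedule : seq (nat * nat) :=
  flatten [seq [seq (h, m) | m <- iota 1 (Lt %/ h)] | h <- iota 1 Lt].

Definition step2 : kstate := foldl step2_one step1 schedule.

Definition xc (j : nat) : X :=
  let cs := undup [seq t.1 | t <- step2.1 & t.2 == j] in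
  let c := ch1 cs (fun c => fval c j) in xr c.1 c.2.

Definition kometo_output : X :=
  xc (ch2 (iota 0 jmax.+1) (fun j => fz (zsel Lt%:R) (xc j))).
End Kometo.

Definition Ltilde (K : nat) (Lam : R) : nat :=
  Num.truncn ((expR 1 - 1) * Lam / (2 * K%:R * expR 1 * (ln Lam + 1) ^+ 2)).

Definition dmax (K : nat) (rho : R) : R := ln K%:R / ln rho^-1.
Definition Cmin (K : nat) (rho d : R) : R :=
  (K%:R * rho `^ d) ^+ (Num.truncn (ln 3 / ln rho^-1)).

End Defs.

(* Main.v *)
(* At depth [h], exactly [floor x - floor (x / e)] iterations are run at level
   [p], where [x = n / (h e^p)], and this is at least [x / 4]. If the cell of
   depth [h] containing the maximizer is flagged at level [p] and all these
   iterations prefer other cells, then, as soon as the bias of level [p] is at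
   most [nu rho^h], the cells they open are [3 nu rho^h]-near-optimal, so there
   are at most [C rho^(-dh)] of them. Hence the cell is opened at a level
   [>= p] as long as [4 C e^p h rho^(-dh) <= n], and the deepest flagged cell
   around the maximizer is a candidate of the final comparison. Each depth in
   the theorem is the solution [h] of this condition with equality, for a real
   level [p] at which the bias is at most [nu rho^h]; rounding [p] up to an
   integer costs a factor [e]. *)

Require Import Defs.
From HB Require Import structures.
From mathcomp Require Import all_boot all_order all_algebra.
From mathcomp Require Import all_classical all_reals all_analysis.
From mathcomp Require Import ring lra.
Set Implicit Arguments. Unset Strict Implicit. Unset Printing Implicit Defensive.
Import Order.TTheory GRing.Theory Num.Theory.
Import numFieldNormedType.Exports.
Local Open Scope classical_set_scope.
Local Open Scope ring_scope.

(** * Real estimates *)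

Section Reals.
Variable R : realType.
Implicit Types x y c w k : R.

(** The intermediate value theorem applies on [[0, w]] because [w <= w * expR w], so the set given
    to [xget] is nonempty. *)
Lemma LambertWP w : 0 <= w ->
  0 <= LambertW w /\ LambertW w * expR (LambertW w) = w.
Proof.
move=> w0; rewrite /LambertW.
apply: (@xgetPex _ 0 [set y : R | 0 <= y /\ y * expR y = w]).
have [||y] := @IVT R (fun y => y * expR y) 0 w w w0.
- apply: continuous_subspaceT; move=> y.
  by apply: continuousM; [exact: cvg_id|exact: continuous_expR].
- have we : w <= w * expR w by rewrite ler_peMr // -expR0 ler_expR.
  rewrite mul0r; apply/andP; split.
    by rewrite ge_min w0.
  by rewrite le_max we orbT.
by rewrite in_itv /= => /andP[y0 _] yw; exists y.
Qed.

(** Each depth in the theorem solves an equation [h * expR (k * h) = w]. Multiplying by [k] gives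
    Lambert's equation for [k * h]; [k = 0] is the origin of the separate case [d = 0]. *)
Lemma LambertW_eq k w : 0 <= k -> 0 <= w ->
  let h := if k == 0 then w else LambertW (k * w) / k in
  0 <= h /\ h * expR (k * h) = w.
Proof.
move=> k0 w0 h; rewrite /h; case: (eqVneq k 0) => [->|kN0].
  by rewrite mul0r expR0 mulr1.
have [W0 WE] := @LambertWP (k * w) (mulr_ge0 k0 w0).
split; first by rewrite divr_ge0.
have -> : k * (LambertW (k * w) / k) = LambertW (k * w) by rewrite mulrC divfK.
by rewrite mulrAC WE [k * w]mulrC mulfK.
Qed.

(** Serves to compare two depths through their defining equations. *)
Lemma mul_expR_le k x y : 0 <= k -> 0 <= x -> 0 <= y ->
  x * expR (k * x) <= y * expR (k * y) -> x <= y.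
Proof.
move=> k0 x0 y0; apply: contraLR; rewrite -!ltNge => yx.
apply: (@le_lt_trans _ _ (y * expR (k * x))).
  by rewrite ler_wpM2l // ler_expR ler_wpM2l // ltW.
by rewrite ltr_pM2r // expR_gt0.
Qed.

(** Rounds a real level up to an integer one. The range starts at -1 because a high budget under (a)
    means exactly that the real level is at least -1. *)
Lemma exists_nat_unit_above x : -1 <= x -> exists p : nat, x <= p%:R <= x + 1.
Proof.
move=> x1; have [x0|x0] := leP x 0; first by exists 0%N; rewrite x0; lra.
have /andP[tl tu] := truncn_itv (ltW x0).
by exists (Num.truncn x).+1; rewrite (ltW tu) -natr1 lerD2r.
Qed.

(** [(5 / 4) ^ 4 = 625 / 256] exceeds [12 / 5], a value precise enough for the count below. *)
Lemma expR1_ge : 12 / 5 <= expR 1 :> R.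
Proof.
have e4 : 5 / 4 <= expR (1 / 4) :> R.
  by apply: le_trans (expR_ge1Dx _); lra.
have -> : expR 1 = expR (1 / 4) ^+ 4 :> R.
  by rewrite -expRM_natl; congr expR; lra.
apply: (@le_trans _ _ ((5 / 4) ^+ 4)); first by lra.
by rewrite ler_pXn2r // nnegrE; [lra|exact: expR_ge0].
Qed.

(* With [x = n / (h e^p)], the right-hand side counts the iterations of Kometo
   that run at level [p] exactly at depth [h]. *)
Lemma truncn_geometric_gap x : 1 <= x ->
  x / 4 <= (Num.truncn x - Num.truncn (x / expR 1))%:R.
Proof.
move=> x1; have e24 := expR1_ge; set e := expR 1 in e24 *.
have x0 : 0 <= x by lra.
have /andP[tl tu] := truncn_itv x0.
have xe : x / e <= x * (5 / 12).
  by rewrite ler_wpM2l // -[leRHS]invrK lef_pV2 ?posrE; lra.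
have xe0 : 0 <= x / e by rewrite divr_ge0 //; lra.
have /andP[tel teu] := truncn_itv xe0.
set a := Num.truncn x in tl tu *; set b := Num.truncn (x / e) in tel teu *.
have ba : (b <= a)%N by apply: le_truncn; lra.
rewrite natrB //.
(* For [x >= 3] the difference is at least [x - 1 - 5 x / 12 >= x / 4]; below 3 the two integer
   parts are bounded directly. *)
have [x2|x2] := ltP x 2.
  have b0 : b = 0%N by apply/eqP; rewrite -leqn0 truncn_le_nat; lra.
  have : (1 <= a)%N by rewrite truncn_gt0.
  by rewrite b0 -(ler_nat R); lra.
have [x3|x3] := ltP x 3.
  have : (b <= 1)%N by rewrite truncn_le_nat; lra.
  have : (2 <= a)%N by rewrite truncn_ge_nat.
  by rewrite -!(ler_nat R); lra.
by move: tu; rewrite -natr1; lra.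
Qed.

(** Together with [level_le], this places at level [p] every iteration [m] with
    [n / (h e^(p+1)) < m <= n / (h e^p)]. *)
Lemma level_ge (n h m p : nat) : (0 < h)%N -> (0 < m)%N ->
  m%:R <= n%:R / (h%:R * expR p%:R) :> R -> (p <= level R n h m)%N.
Proof.
move=> h0 m0 mn; have hR : 0 < h%:R :> R by rewrite ltr0n.
have mR : 0 < m%:R :> R by rewrite ltr0n.
have e0 := expR_gt0 (p%:R : R).
have pn : expR p%:R <= n%:R / (h * m)%:R :> R.
  rewrite ler_pdivlMr ?natrM ?mulr_gt0 //.
  by move: mn; rewrite ler_pdivlMr ?mulr_gt0 //; congr (_ <= _); ring.
have pl : p%:R <= ln (n%:R / (h * m)%:R) :> R.
  by rewrite -ler_expR lnK // posrE; apply: lt_le_trans pn.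
by rewrite /level truncn_ge_nat //; apply: le_trans pl.
Qed.

Lemma level_le (n h m p : nat) : (0 < h)%N -> (0 < m)%N ->
  n%:R / (h%:R * expR p.+1%:R) < m%:R :> R -> (level R n h m <= p)%N.
Proof.
move=> h0 m0 mn; have hR : 0 < h%:R :> R by rewrite ltr0n.
have mR : 0 < m%:R :> R by rewrite ltr0n.
have e0 := expR_gt0 (p.+1%:R : R).
(* For [n = 0] the logarithm is taken at 0, where its default value is 0. *)
have [n0|n0] := posnP n.
  by rewrite /level n0 mul0r ln0 // truncn0.
have pn : n%:R / (h * m)%:R < expR p.+1%:R :> R.
  rewrite ltr_pdivrMr ?natrM ?mulr_gt0 //.
  by move: mn; rewrite ltr_pdivrMr ?mulr_gt0 //; congr (_ < _); ring.
rewrite /level truncn_le_nat -ltr_expR lnK // posrE divr_gt0 ?ltr0n //.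
by rewrite muln_gt0 h0.
Qed.

End Reals.

(** * Cells opened by Kometo *)

Section Run.
Variables (R : realType) (X : Type) (K : nat) (xr : nat -> nat -> X).
Variables (fz : R -> X -> R) (zsel : R -> R) (n : nat).
Variable ch1 : seq (nat * nat) -> (nat * nat -> R) -> nat * nat.
Hypothesis ch1P : argmax_spec ch1.
Local Notation val := (fval xr fz zsel).
Local Notation step := (step2_one K xr fz zsel n ch1).
Local Notation lvl := (level R n).
Implicit Types (st : kstate) (c : nat * nat) (p h m : nat).

Definition kids_flagged st c p :=
  forall l, (l < K)%N -> ((c.1.+1, K * c.2 + l)%N, p) \in st.1.

(** Without duplicates, the length of the opened list counts cells; with indices in range, these are
    among the [K ^ h] cells of their depth. *)
Definition wf_state st :=
  (forall t, t \in st.1 -> (t.1.2 < K ^ t.1.1)%N) /\ uniq st.2.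

Lemma mem_candidates st h j c :
  (c \in candidates st h j) = [&& c.1 == h, (c, j) \in st.1 & c \notin st.2].
Proof.
rewrite mem_undup; apply/mapP/idP => [[[c' u]]|/and3P[ch cj cN]].
  by rewrite mem_filter /= => /andP[/and3P[ch /eqP <- cN] cu] ->; rewrite ch cu.
by exists (c, j) => //; rewrite mem_filter /= ch eqxx cN.
Qed.

Lemma open_cell_kids st c j p :
  (p <= j)%N -> kids_flagged (open_cell K st c j) c p.
Proof.
move=> pj l lK; rewrite /open_cell mem_cat; apply/orP; left.
by apply: allpairs_f; rewrite mem_iota ?ltnS.
Qed.

Lemma wf_open_cell st c j : wf_state st -> (c.2 < K ^ c.1)%N -> c \notin st.2 ->
  wf_state (open_cell K st c j).
Proof.
move=> [fl un] cK cN; split; last by rewrite /= cN un.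
move=> t; rewrite mem_cat => /orP[|]; last exact: fl.
move=> /allpairsP[[l u]] /= []; rewrite !mem_iota /= => lK _ -> /=.
rewrite expnS; apply: (@leq_trans (K * c.2.+1)%N); last by rewrite leq_mul2l cK orbT.
by rewrite mulnSr -ltn_subRL addKn; move: lK; rewrite add0n.
Qed.

(** Hides the choice function [ch1] behind the optimality of the cell it selects. *)
Variant step_spec st (hm : nat * nat) : kstate -> Prop :=
  | StepIdle of candidates st hm.1 (lvl hm.1 hm.2) = [::] : step_spec st hm st
  | StepOpen c of c.1 = hm.1 & (c, lvl hm.1 hm.2) \in st.1 & c \notin st.2
      & (forall y, y \in candidates st hm.1 (lvl hm.1 hm.2) ->
           val y (lvl hm.1 hm.2) <= val c (lvl hm.1 hm.2)) :
      step_spec st hm (open_cell K st c (lvl hm.1 hm.2)).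

Lemma stepP st hm : step_spec st hm (step st hm).
Proof.
rewrite /step2_one.
case cE: (candidates st hm.1 _) => [|c0 s]; first exact: StepIdle.
have [] := @ch1P _ (fun c => val c (lvl hm.1 hm.2)) (_ : c0 :: s != [::]) => //.
rewrite -cE mem_candidates => /and3P[/eqP ch cu cN] mx.
by apply: StepOpen.
Qed.

Lemma wf_step st hm : wf_state st -> wf_state (step st hm).
Proof.
move=> wf; case: stepP => // c _ cu cN _.
by apply: wf_open_cell => //; exact: (proj1 wf _ cu).
Qed.

Lemma wf_steps s st : wf_state st -> wf_state (foldl step st s).
Proof. by elim: s st => [|hm s IH] st wf //=; apply: IH; apply: wf_step. Qed.

Lemma step_flags st hm : {subset st.1 <= (step st hm).1}.
Proof. by move=> t tst; case: stepP => // c *; rewrite mem_cat tst orbT. Qed.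

Lemma steps_flags s st : {subset st.1 <= (foldl step st s).1}.
Proof. by elim: s st => [|hm s IH] st t tst //=; apply: IH; apply: step_flags. Qed.

Lemma step_opened st hm c : c \in (step st hm).2 -> c \in st.2 \/ c.1 = hm.1.
Proof.
case: stepP; first by left.
by move=> c' ch _ _ _ /=; rewrite inE => /orP[/eqP ->|]; [right|left].
Qed.

(** Ensures that no cell of depth [h] has been opened when the phase of depth [h] begins. *)
Lemma phase_opened h (ms : seq nat) st c :
  c \in (foldl step st [seq (h, m) | m <- ms]).2 -> c \in st.2 \/ c.1 = h.
Proof.
elim: ms st => [|m ms IH] st /=; first by left.
by move=> /IH[/step_opened|]; [|right].
Qed.

(** Opening at level [j] flags the children at all levels up to [j], so an opening at any level
    above [p] is as good as one at [p]. *)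
Lemma step_opened_kids st h m c p : (p <= lvl h m)%N ->
  (c \in st.2 -> kids_flagged st c p) ->
  c \in (step st (h, m)).2 -> kids_flagged (step st (h, m)) c p.
Proof.
move=> pm cst; case: stepP => // c' _ _ _ _ /=; rewrite inE => /orP[/eqP ->|/cst kf].
  exact: open_cell_kids.
by move=> l /kf lst; rewrite mem_cat lst orbT.
Qed.

Lemma phase_opened_kids h p (ms : seq nat) st c :
  (forall m, m \in ms -> p <= lvl h m)%N ->
  (c \in st.2 -> kids_flagged st c p) ->
  let st' := foldl step st [seq (h, m) | m <- ms] in
  c \in st'.2 -> kids_flagged st' c p.
Proof.
elim: ms st => //= m ms IH st pm cst.
apply: IH => [m' m'ms|]; first by apply: pm; rewrite inE m'ms orbT.
by apply: step_opened_kids => //; apply: pm; rewrite inE eqxx.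
Qed.

(** While [c] is flagged and unopened it is a candidate, so no iteration is idle and each one opens
    a cell at least as good as [c] at level [p]. *)
Lemma phase_level_eq h p (ms : seq nat) st c :
  (forall m, m \in ms -> lvl h m = p) -> c.1 = h -> (c, p) \in st.1 ->
  let st' := foldl step st [seq (h, m) | m <- ms] in
  wf_state st -> c \notin st'.2 ->
  exists2 s, st'.2 = s ++ st.2 & size s = size ms /\
    forall c', c' \in s -> [/\ c'.1 = h, (c'.2 < K ^ h)%N & val c p <= val c' p].
Proof.
elim: ms st => [|m ms IH] st /=; first by exists [::].
move=> mp ch cp wf cN.
(* Opened cells stay opened, so [c], unopened at the end, was unopened throughout. *)
have mem_opened (s : seq (nat * nat)) st1 : {subset st1.2 <= (foldl step st1 s).2}.
  elim: s st1 => [|hm s IHs] st1 x xst //=; apply: IHs.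
  by case: stepP => // *; rewrite inE xst orbT.
have {}cN' : c \notin (step st (h, m)).2 by apply: contra cN; apply: mem_opened.
have mp' m' : m' \in ms -> lvl h m' = p by move=> m's; apply: mp; rewrite inE m's orbT.
have [s sE [ss sP]] := IH _ mp' ch (step_flags (h, m) cp) (wf_step _ wf) cN.
have lm : lvl h m = p by apply: mp; rewrite inE eqxx.
move: sE cN'; case: stepP => /=; rewrite lm.
  move=> c0 _ cst.
  have : c \in candidates st h p by rewrite mem_candidates ch eqxx cp cst.
  by rewrite c0.
move=> c' c'h c'p _ mx sE; rewrite inE negb_or => /andP[_ cst].
(* The opened list grows at its head, so the cell of the first iteration comes last in [s]. *)
exists (rcons s c'); first by rewrite sE cat_rcons.
split=> [|x]; first by rewrite size_rcons ss.
rewrite mem_rcons inE => /orP[/eqP ->|/sP //]; split => //.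
  by have := proj1 wf _ c'p; rewrite /= c'h.
by apply: mx; rewrite mem_candidates ch eqxx cp cst.
Qed.

(* If [c] survived the iterations [m1 < m <= m2], all run at level [p], then
   [m2 - m1] other cells would have beaten it at that level. *)
Lemma phase_opens h p m1 m2 N st c :
  (m1 <= m2 <= N)%N ->
  (forall m, 0 < m <= m2 -> p <= lvl h m)%N ->
  (forall m, m1 < m <= m2 -> lvl h m = p)%N ->
  c.1 = h -> (c, p) \in st.1 -> c \notin st.2 -> wf_state st ->
  (count (fun i => val c p <= val (h, i) p)%R (iota 0 (K ^ h)) <= m2 - m1)%N ->
  kids_flagged (foldl step st [seq (h, m) | m <- iota 1 N]) c p.
Proof.
move=> /andP[m12 m2N] plvl lvlp ch cp cst wf cnt.
rewrite -(subnKC m2N) iotaD map_cat foldl_cat.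
set st2 := foldl _ _ [seq (h, m) | m <- iota 1 m2].
suff kf : kids_flagged st2 c p by move=> l /kf; exact: steps_flags.
have okids : c \in st2.2 -> kids_flagged st2 c p.
  apply: phase_opened_kids => [m|]; last by rewrite (negbTE cst).
  by rewrite mem_iota add1n ltnS => /plvl.
apply: okids; apply/negPn/negP => cN.
move: cnt; apply/negP; rewrite -ltnNge.
have iE : iota 1 m2 = iota 1 m1 ++ iota m1.+1 (m2 - m1).
  by rewrite -[in LHS](subnKC m12) iotaD add1n.
move: cN; rewrite /st2 iE map_cat foldl_cat => cN.
set st1 := foldl step st _ in cN.
have wf1 : wf_state st1 by exact: wf_steps.
have lvl2 m : m \in iota m1.+1 (m2 - m1) -> lvl h m = p.
  rewrite mem_iota addSn subnKC // ltnS; exact: lvlp.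
have [s sE [ss sP]] := @phase_level_eq h p _ st1 c lvl2 ch
  (steps_flags _ cp) wf1 cN.
have [_] := wf_steps [seq (h, m) | m <- iota m1.+1 (m2 - m1)] wf1.
rewrite sE cat_uniq => /and3P[us _ _].
have cs : c \notin s by move: cN; rewrite sE mem_cat negb_or => /andP[].
(* Since [c] ties with itself, it is counted along with the [m2 - m1] cells of [s]: one more than
   [cnt] allows. *)
have <- : size (c :: s) = (m2 - m1).+1 by rewrite /= ss size_iota.
rewrite -size_filter -(size_map snd); apply: uniq_leq_size.
  rewrite map_inj_in_uniq; first by rewrite /= cs us.
  have h1 x : x \in c :: s -> x.1 = h by rewrite inE => /orP[/eqP ->|/sP[]].
  by move=> [x1 x2] [y1 y2] /h1 /= -> /h1 /= -> ->.
move=> i /mapP[x xs ->]; rewrite mem_filter mem_iota add0n /=.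
move: xs; rewrite inE => /orP[/eqP ->|/sP[xh xK cx]].
  by rewrite -{1}ch -surjective_pairing lexx -ch /=; apply: (proj1 wf (c, p)).
by rewrite -{1}xh -surjective_pairing cx.
Qed.

(** * Flags along a family of cells closed under taking parents *)

Variable star : nat -> nat -> Prop.
Hypothesis star_parent : forall h i, star h.+1 i -> star h (i %/ K)%N.
Hypothesis K_gt0 : (0 < K)%N.

Let phases H := flatten [seq [seq (h, m) | m <- iota 1 (n %/ h)] | h <- iota 1 H].

(** Induction on the depth: opening the root flags depth 1 at every level up to [jmax], and phase
    [h] opens the [star] cell of depth [h], which flags its child. Hence [H] phases reach depth
    [H.+1]. The bound on opened depths shows that the next [star] cell is still unopened. *)
Lemma phases_star_flagged p H : (p <= jmax R n)%N ->
  (forall h i, (0 < h <= H)%N -> (i < K ^ h)%N -> star h i ->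
     exists m1 m2, [/\ (m1 <= m2 <= n %/ h)%N,
       (forall m, 0 < m <= m2 -> p <= lvl h m)%N,
       (forall m, m1 < m <= m2 -> lvl h m = p)%N
     & (count (fun k => val (h, i) p <= val (h, k) p)%R (iota 0 (K ^ h))
         <= m2 - m1)%N]) ->
  let st := foldl step (step1 R K n) (phases H) in
  [/\ wf_state st, (forall c, c \in st.2 -> c.1 <= H)%N &
      forall i, (i < K ^ H.+1)%N -> star H.+1 i -> ((H.+1, i), p) \in st.1].
Proof.
move=> pj; elim: H => [|H IH] hyp /=.
  split; first by apply: wf_open_cell => //; split.
    by move=> c; rewrite inE => /eqP ->.
  move=> i; rewrite expn1 => iK _.
  by have /= := @open_cell_kids ([::], [::]) (0%N, 0%N) _ _ pj i iK; rewrite muln0.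
have [|wf dep fl] := IH.
  by move=> h i /andP[h0 hH]; apply: hyp; rewrite h0 leqW.
have iE : iota 1 H.+1 = rcons (iota 1 H) H.+1.
  by have := iotaD 1 H 1; rewrite addn1 add1n cats1.
rewrite /phases iE map_rcons flatten_rcons foldl_cat -/(phases H).
set st := foldl _ _ _ in wf dep fl *.
split; first exact: wf_steps.
  by move=> c /phase_opened[/dep /leqW|->].
move=> i iK /star_parent si.
have iKH : (i %/ K < K ^ H.+1)%N by rewrite ltn_divLR // mulnC -expnS.
have [//|m1 [m2 [m12 lm le cnt]]] := hyp H.+1 _ _ iKH si; first by rewrite leqnn.
rewrite {1}(divn_eq i K) mulnC.
apply: (@phase_opens H.+1 p m1 m2 _ _ (H.+1, (i %/ K)%N)) => //.
- exact: fl.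
- by apply/negP => /dep /=; rewrite ltnn.
- by rewrite ltn_mod.
Qed.

Lemma step2_star_flagged p H : (p <= jmax R n)%N -> (H <= n)%N ->
  (forall h i, (0 < h <= H)%N -> (i < K ^ h)%N -> star h i ->
     exists m1 m2, [/\ (m1 <= m2 <= n %/ h)%N,
       (forall m, 0 < m <= m2 -> p <= lvl h m)%N,
       (forall m, m1 < m <= m2 -> lvl h m = p)%N
     & (count (fun k => val (h, i) p <= val (h, k) p)%R (iota 0 (K ^ h))
         <= m2 - m1)%N]) ->
  forall i, (i < K ^ H.+1)%N -> star H.+1 i ->
    ((H.+1, i), p) \in (step2 K xr fz zsel n ch1).1.
Proof.
move=> pj Hn hyp i iK si; rewrite /step2 /schedule -(subnKC Hn) iotaD map_cat.
rewrite flatten_cat foldl_cat subnKC //; apply: steps_flags.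
by have [_ _] := phases_star_flagged pj hyp; apply.
Qed.

End Run.

(** * Regret bounds *)

Lemma powR_expR_lnV (R : realType) (rho x : R) : 0 < rho ->
  rho `^ x = expR (- (ln rho^-1 * x)).
Proof. by move=> r0; rewrite lnV ?posrE // mulNr opprK expRM lnK. Qed.

Lemma ler_powR_anti (R : realType) (rho x y : R) : 0 < rho < 1 -> x <= y ->
  rho `^ y <= rho `^ x.
Proof.
move=> /andP[r0 r1] xy; rewrite !powR_expR_lnV // ler_expR lerN2 ler_wpM2l //.
by rewrite ln_ge0 // invf_ge1 // ltW.
Qed.

Lemma fmaxE (R : realType) (X : Type) (f : X -> R) (xs : X) :
  (forall x, f x <= f xs) -> fmax f = f xs.
Proof.
move=> mx; apply/eqP; rewrite eq_le; apply/andP; split.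
  by apply: ge_sup => [|_ [x _ <-]]; [exists (f xs), xs|].
by apply: ub_le_sup; [exists (f xs) => _ [x _ <-]|exists xs].
Qed.

(** What a bias bound [phi] says about comparisons of fidelity values, freed of the unknown
    rescaling [g]. *)
Definition ordered_upto (R : realType) (X : Type) (f F : X -> R) (phi : R) :=
  forall x y, F x <= F y -> f x <= f y + 2 * phi.

Lemma bias_ordered (R : realType) (X : Type) (f F : X -> R) (g : R -> R) (phi : R) :
  {homo g : a b / a < b} -> (forall x, `|f x - g (F x)| <= phi) ->
  ordered_upto f F phi.
Proof.
move=> gm bias x y; rewrite le_eqVlt => Fxy.
have {Fxy} : g (F x) <= g (F y).
  by move: Fxy => /orP[/eqP -> //|/gm/ltW].
have := bias x; have := bias y; rewrite !ler_norml; lra.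
Qed.

Section Regret.
Variables (R : realType) (X : Type) (K : nat) (P : nat -> nat -> set X).
Variables (xr : nat -> nat -> X) (nu rho d C : R) (f : X -> R).
Variables (fz : R -> X -> R) (zsel : R -> R).
Variable ch1 : seq (nat * nat) -> (nat * nat -> R) -> nat * nat.
Variable ch2 : seq nat -> (nat -> R) -> nat.
Hypotheses (K2 : (2 <= K)%N) (partP : hier_partition K P xr).
Hypotheses (nu0 : 0 < nu) (rho01 : 0 < rho < 1) (fS : in_S K P nu rho d C f).
Hypotheses (ch1P : argmax_spec ch1) (ch2P : argmax_spec ch2).

Lemma regret_le_nu x : fmax f - f x <= nu.
Proof.
have [[xs [mx sm]] _] := fS; have [P0 _ _ _] := partP.
have := sm 0%N 0%N; rewrite P0 expr0 mulr1 (fmaxE mx) => /(_ isT I x I); lra.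
Qed.

Let star xs h i : Prop := (i < K ^ h)%N /\ P h i xs.

Lemma star_parent xs h i : star xs h.+1 i -> star xs h (i %/ K)%N.
Proof.
have K0 : (0 < K)%N by apply: leq_trans K2.
have [_ ch _ _] := partP; rewrite /star expnS mulnC => -[iK Pi].
have iKh : (i %/ K < K ^ h)%N by rewrite ltn_divLR.
split=> //; rewrite ch //; exists (i %% K)%N; first by rewrite /= ltn_mod.
by rewrite [(K * _)%N]mulnC -divn_eq.
Qed.

Lemma star_exists xs h : exists i, star xs h i.
Proof.
have [P0 ch _ _] := partP.
elim: h => [|h [i [iK]]]; first by exists 0%N; split=> //; rewrite P0.
rewrite ch // => -[l /= lK Pl]; exists (K * i + l)%N; split=> //.
rewrite expnS; apply: (@leq_trans (K * i.+1)%N); last by rewrite leq_mul2l iK orbT.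
by rewrite mulnS addnC ltn_add2r.
Qed.

(** The supremum of [f] over a cell dominates its value at the representative, so a near-optimal
    representative makes its cell near-optimal. *)
Lemma count_le_Nh xs h (q : pred nat) : (forall x, f x <= f xs) ->
  (forall i, (i < K ^ h)%N -> q i -> f xs - 3 * nu * rho ^+ h <= f (xr h i)) ->
  (count q (iota 0 (K ^ h)) <= Nh K P f h (3 * nu * rho ^+ h))%N.
Proof.
have [_ _ _ rep] := partP; move=> mx near.
rewrite /Nh -!size_filter; apply: uniq_leq_size; first by rewrite filter_uniq ?iota_uniq.
move=> i; rewrite !mem_filter mem_iota add0n /= => /andP[qi iK]; rewrite iK andbT.
apply/asboolP; apply: (@le_trans _ _ (f (xr h i))%:E).
  by rewrite lee_fin (fmaxE mx) near.
by apply: ereal_sup_ubound; exists (xr h i) => //; apply: rep.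
Qed.

(** Three losses add up: the representative of the flagged cell around the maximizer at depth
    [floor h + 1], the selection at level [p], and the final comparison at fidelity [n]. *)
Lemma kometo_regret (n p : nat) (h phi psi : R) :
  1 <= h -> 0 <= phi -> phi <= nu * rho `^ h ->
  ordered_upto f (fz (zsel (expR p%:R))) phi ->
  ordered_upto f (fz (zsel n%:R)) psi ->
  4 * C * expR p%:R * (h * rho `^ (- (d * h))) <= n%:R ->
  fmax f - f (kometo_output K xr fz zsel n ch1 ch2) <=
    nu * rho `^ h + 2 * phi + 2 * psi.
Proof.
move=> h1 phi0 phile ordp ordn hn.
have [[xs [mx sm]] [d0 [C1 NhC]]] := fS; have [_ _ _ rep] := partP.
have /andP[r0 r1] := rho01; have hp : 0 <= h by lra.
have K0 : (0 < K)%N by apply: leq_trans K2.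
have rhoX k : rho ^+ k = rho `^ k%:R by rewrite powR_mulrn // ltW.
have powV x : 0 <= x -> 1 <= rho `^ (- (d * x)).
  move=> x0; rewrite -(powRr0 rho); apply: ler_powR_anti => //.
  by rewrite oppr_le0 mulr_ge0.
have ep1 : 1 <= expR p%:R :> R by rewrite -expR0 ler_expR.
have ep0 : 0 < expR p%:R :> R := expR_gt0 _.
have /andP[tl tu] := truncn_itv hp; set H := Num.truncn h in tl tu *.
have mul_ge1 (x y : R) : 0 <= x -> 1 <= y -> x <= x * y by move=> ? ?; rewrite ler_peMr.
have hn1 : 4 * C * expR p%:R * h <= n%:R.
  by apply: le_trans hn; rewrite mulrA mul_ge1 // ?powV // !mulr_ge0 //; lra.
have epn : expR p%:R <= n%:R :> R.
  apply: le_trans hn1; have -> : 4 * C * expR p%:R * h = expR p%:R * (4 * C * h) by ring.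
  by apply: mul_ge1; [exact: ltW|nra].
have Hn : (H <= n)%N.
  rewrite -(ler_nat R); apply: le_trans tl _; apply: le_trans hn1.
  by rewrite mulrC; apply: mul_ge1; [|nra].
have n0 : 0 < n%:R :> R by apply: lt_le_trans epn.
have pj : (p <= jmax R n)%N.
  have pl : p%:R <= ln (n%:R : R) by rewrite -ler_expR lnK.
  by rewrite /jmax truncn_ge_nat //; apply: le_trans pl.
have rep_star k i : star xs k i -> f xs - nu * rho ^+ k <= f (xr k i).
  by move=> [iK Pi]; apply: (sm k i iK Pi); apply: rep.
have [i si] := star_exists xs H.+1; have [iK _] := si.
have fl : ((H.+1, i), p) \in (step2 K xr fz zsel n ch1).1.
  apply: (step2_star_flagged ch1P (@star_parent xs) K0 pj Hn) iK si => k j.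
  move=> /andP[k0 kH] jK sj.
  have kh : k%:R <= h by apply: le_trans tl; rewrite ler_nat.
  have kR : 0 < k%:R :> R by rewrite ltr0n.
  have kn : 4 * (C * rho `^ (- (d * k%:R))) <= n%:R / (k%:R * expR p%:R).
    rewrite ler_pdivlMr ?mulr_gt0 //; apply: le_trans hn.
    have -> : 4 * (C * rho `^ (- (d * k%:R))) * (k%:R * expR p%:R) =
      4 * C * expR p%:R * (k%:R * rho `^ (- (d * k%:R))) by ring.
    rewrite ler_wpM2l //; first by rewrite !mulr_ge0 //; lra.
    apply: ler_pM; rewrite ?powR_ge0 ?ler0n //.
    by apply: ler_powR_anti => //; rewrite lerN2 ler_wpM2l.
  set x := n%:R / _ in kn.
  have x1 : 1 <= x.
    apply: le_trans kn; have := powV _ (ltW kR).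
    by move: C1; set y := rho `^ _; nra.
  have x0 : 0 <= x by lra.
  have xe : x / expR 1 = n%:R / (k%:R * expR p.+1%:R).
    by rewrite /x -addn1 natrD expRD mulrA [in RHS]invfM mulrA.
  have xe0 : 0 <= x / expR 1 by rewrite divr_ge0 ?expR_ge0.
  (* The iterations between these two integers are those at level exactly [p]. *)
  exists (Num.truncn (x / expR 1)), (Num.truncn x).
  have lge m : (0 < m <= Num.truncn x)%N -> (p <= level R n k m)%N.
    by move=> /andP[m0]; rewrite truncn_ge_nat // => /(level_ge k0 m0).
  split => //.
  - apply/andP; split.
      apply: le_truncn; rewrite ler_pdivrMr ?expR_gt0 // mul_ge1 //.
      by rewrite -expR0 ler_expR.
    rewrite leq_divRL // -(ler_nat R) natrM.
    have := truncn_itv x0 => /andP[tx _].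
    apply: le_trans (ler_wpM2r (ltW kR) tx) _.
    rewrite /x -mulrA ler_piMr ?ler0n // invfM mulrAC mulVf ?gt_eqF // mul1r.
    by rewrite invf_le1.
  - move=> m /andP[m1 m2]; have m0 : (0 < m)%N by apply: leq_trans m1.
    apply/eqP; rewrite eqn_leq lge ?m0 // andbT; apply: level_le => //.
    by move: m1; rewrite truncn_lt_nat // xe.
  (* A cell beating the maximizer's cell at level [p] loses at most
     [nu rho^k + 2 phi <= 3 nu rho^k]. At most [C rho^(-dk) <= x / 4] cells do so, and [x / 4] is at
     most the number of iterations at level [p]. *)
  - apply: (@leq_trans (Nh K P f k (3 * nu * rho ^+ k))).
      apply: count_le_Nh mx _ => l lK /ordp /=.
      have := rep_star _ _ sj.
      have : nu * rho `^ h <= nu * rho ^+ k.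
        by rewrite ler_pM2l // rhoX ler_powR_anti.
      move: phile; set a := nu * _ ^+ _; set b := nu * _ `^ _.
      by rewrite -mulrA -/a; lra.
    rewrite -(ler_nat R); apply: le_trans (truncn_geometric_gap x1).
    by apply: le_trans (NhC k) _; lra.
have ordc : f (xr H.+1 i) <= f (xc K xr fz zsel n ch1 p) + 2 * phi.
  apply: ordp; rewrite /xc.
  set cs := undup _; have ics : (H.+1, i) \in cs.
    by rewrite mem_undup; apply/mapP; exists ((H.+1, i), p) => //; rewrite mem_filter eqxx.
  have [|_ /(_ _ ics)] // := @ch1P cs (fun c => fval xr fz zsel c p).
  by case: (cs) ics.
have ordo : f (xc K xr fz zsel n ch1 p) <=
    f (kometo_output K xr fz zsel n ch1 ch2) + 2 * psi.
  apply: ordn; rewrite /kometo_output.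
  have [//|_] := @ch2P (iota 0 (jmax R n).+1)
    (fun j => fz (zsel n%:R) (xc K xr fz zsel n ch1 j)).
  by apply; rewrite mem_iota.
have := rep_star _ _ si.
(* The flagged depth [H.+1] exceeds the real depth [h]. *)
have : nu * rho ^+ H.+1 <= nu * rho `^ h.
  by rewrite ler_pM2l // rhoX ler_powR_anti // ltW.
rewrite (fmaxE mx); lra.
Qed.

(** * Choice of the level under each assumption on the bias *)

Local Notation L := (ln rho^-1).

(** The factor 3 absorbs [2 phi], and [1 / rho] makes the bound trivial for [h < 1]. For [h >= 1]
    the budget condition forces [n > 0], so that fidelity [n] has cost parameter at least 1. *)
Lemma kometo_regret_biased (n p : nat) (h phi psi : R) :
  0 <= h -> 0 <= phi -> phi <= nu * rho `^ h -> 0 <= psi ->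
  ordered_upto f (fz (zsel (expR p%:R))) phi ->
  ((0 < n)%N -> ordered_upto f (fz (zsel n%:R)) psi) ->
  4 * C * expR p%:R * (h * expR (d * L * h)) <= n%:R ->
  fmax f - f (kometo_output K xr fz zsel n ch1 ch2) <=
    3 * nu / rho * rho `^ h + 2 * psi.
Proof.
move=> h0 phi0 phile psi0 ordp ordn hn.
have /andP[r0 r1] := rho01; have [_ [_ [C1 _]]] := fS.
have rh0 : 0 <= rho `^ h := powR_ge0 _ _.
have rhoV : 1 <= rho^-1 by rewrite invf_ge1 // ltW.
have [h1|h1] := ltP h 1.
  have rr : 1 <= rho^-1 * rho `^ h.
    by rewrite ler_pdivlMl // mulr1 -{1}(powRr1 (ltW r0)) ler_powR_anti // ltW.
  have : nu <= nu * (rho^-1 * rho `^ h) by rewrite ler_peMr // ltW.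
  have := regret_le_nu (kometo_output K xr fz zsel n ch1 ch2).
  have -> : 3 * nu / rho * rho `^ h = 3 * (nu * (rho^-1 * rho `^ h)) by ring.
  by set x := nu * _; set y := f _; move: nu0 psi0; lra.
have n0 : (0 < n)%N.
  rewrite -(ltr0n R); apply: lt_le_trans hn.
  by rewrite !mulr_gt0 ?expR_gt0 //; lra.
have powE : rho `^ (- (d * h)) = expR (d * L * h).
  by rewrite powR_expR_lnV //; congr expR; ring.
rewrite -powE in hn.
apply: le_trans (kometo_regret h1 phi0 phile ordp (ordn n0) hn) _.
rewrite lerD2r.
have : nu * rho `^ h <= nu * rho `^ h * rho^-1 by rewrite ler_peMr // mulr_ge0 // ltW.
have -> : 3 * nu / rho * rho `^ h = 3 * (nu * rho `^ h * rho^-1) by ring.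
lra.
Qed.

Lemma in_F_ordered (Asm : (R -> \bar R) -> Prop) lam :
  in_F Asm f lam zsel fz -> exists2 Phi, Asm Phi &
    forall c phi, 1 <= c -> (Phi c <= phi%:E)%E -> ordered_upto f (fz (zsel c)) phi.
Proof.
move=> [av [zeta [g [_ gm bias as_]]]]; exists (fun c => zeta (zsel c)) => //.
move=> c phi c1 zphi; have [zc _] := av _ c1.
apply: (bias_ordered (gm _ zc)) => x; rewrite -lee_fin.
by apply: le_trans zphi; apply: bias.
Qed.

Lemma expR_nat_ge1 (p : nat) : 1 <= expR p%:R :> R.
Proof. by rewrite -expR0 ler_expR. Qed.

Lemma ln_invr_gt0 : 0 < L.
Proof. by have /andP[r0 r1] := rho01; rewrite ln_gt0 // invf_gt1. Qed.

Lemma depth_eq (lt den : R) : 0 <= lt -> 0 < den ->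
  let h := if d == 0 then lt / den else LambertW (lt * d * L / den) / (d * L) in
  0 <= h /\ h * expR (d * L * h) = lt / den.
Proof.
move=> lt0 den0; have [_ [d0 _]] := fS.
have -> : lt * d * L / den = d * L * (lt / den) by ring.
have := @LambertW_eq _ (d * L) (lt / den).
rewrite mulf_eq0 (gt_eqF ln_invr_gt0) orbF; apply; first by rewrite mulr_ge0 // ltW // ln_invr_gt0.
by rewrite divr_ge0 // ltW.
Qed.

Lemma regret_a_high lam n A alpha h : 0 < A -> 0 < alpha ->
  in_F (asm_a A alpha) f lam zsel fz -> 0 <= h ->
  h * expR ((d + alpha^-1) * L * h) =
    n%:R * nu `^ alpha^-1 / (4 * C * expR 1 * A `^ alpha^-1) ->
  nu * rho `^ h <= expR alpha * A ->
  fmax f - f (kometo_output K xr fz zsel n ch1 ch2) <=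
    3 * nu / rho * rho `^ h + 2 * (A / n%:R `^ alpha).
Proof.
move=> A0 al0 /in_F_ordered[Phi PhiA ordPhi] h0 hE high.
have /andP[r0 r1] := rho01; have [_ [_ [C1 _]]] := fS.
have [aA AE] : exists a, A = expR a by exists (ln A); rewrite lnK.
have [a nuE] : exists a, nu = expR a by exists (ln nu); rewrite lnK.
have aN0 : alpha != 0 by rewrite gt_eqF.
(* The real level at which the bias bound equals the target: [A e^(-alpha q) = nu rho^h]. The
   high-budget condition reads [q >= -1]. *)
set q := (L * h + aA - a) / alpha.
have qE : q * alpha = L * h + aA - a by rewrite divfK.
have q1 : -1 <= q.
  rewrite -(ler_pM2r al0) qE mulN1r; move: high.
  by rewrite (powR_expR_lnV _ r0) nuE AE -!expRD ler_expR; lra.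
have [p /andP[qp pq]] := exists_nat_unit_above q1.
have ep := expR_nat_ge1 p.
apply: (@kometo_regret_biased n p h (A / expR p%:R `^ alpha)) => //.
- by rewrite divr_ge0 ?powR_ge0 // ltW.
- rewrite (powR_expR_lnV _ r0) -expRM AE nuE -expRD -expRN -expRD ler_expR.
  by have := ler_wpM2r (ltW al0) qp; rewrite qE; lra.
- by rewrite divr_ge0 ?powR_ge0 // ltW.
- by apply: ordPhi => //; apply: PhiA.
- move=> n0; have n1 : 1 <= n%:R :> R by rewrite ler1n.
  by apply: ordPhi => //; apply: PhiA.
have e0 : 0 <= h * expR (d * L * h) by rewrite mulr_ge0 ?expR_ge0.
apply: (@le_trans _ _ (4 * C * expR (q + 1) * (h * expR (d * L * h)))).
  rewrite ler_wpM2r // ler_wpM2l ?ler_expR //; lra.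
(* The factor [e^q] contributes [e^(L h / alpha)], which changes the exponent [d] into
   [d + 1 / alpha] as in the equation of [h]. *)
have -> : 4 * C * expR (q + 1) * (h * expR (d * L * h)) =
   4 * C * expR 1 * expR ((aA - a) / alpha) * (h * expR ((d + alpha^-1) * L * h)).
  rewrite expRD; have -> : q = (aA - a) / alpha + alpha^-1 * L * h by rewrite /q; ring.
  by rewrite !mulrDl !expRD; ring.
rewrite hE nuE AE -!expRM mulrBl expRB.
have := expR_gt0 (aA * alpha^-1 : R); have := expR_gt0 (a * alpha^-1 : R).
have := expR_gt0 (1 : R).
set x := expR 1; set y := expR (aA / _); set z := expR (a / _) => x0 z0 y0.
by rewrite le_eqVlt; apply/orP; left; apply/eqP; field; rewrite !gt_eqF //; lra.
Qed.

(** Level 0 suffices: its bias is at most [A], below [nu rho^h] by the low-budget condition, hence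
    below [nu rho^h2] once [h2 <= h]. *)
Lemma regret_a_low lam n A alpha h h2 : 0 < A -> 0 < alpha ->
  in_F (asm_a A alpha) f lam zsel fz -> 0 <= h ->
  h * expR ((d + alpha^-1) * L * h) =
    n%:R * nu `^ alpha^-1 / (4 * C * expR 1 * A `^ alpha^-1) ->
  nu * rho `^ h > expR alpha * A ->
  0 <= h2 -> h2 * expR (d * L * h2) = n%:R / (4 * C) ->
  fmax f - f (kometo_output K xr fz zsel n ch1 ch2) <=
    3 * nu / rho * rho `^ h2 + 2 * (A / n%:R `^ alpha).
Proof.
move=> A0 al0 /in_F_ordered[Phi PhiA ordPhi] h0 hE low h20 h2E.
have /andP[r0 r1] := rho01; have [_ [d0 [C1 _]]] := fS.
have [aA AE] : exists a, A = expR a by exists (ln A); rewrite lnK.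
have [a nuE] : exists a, nu = expR a by exists (ln nu); rewrite lnK.
have L0 := ln_invr_gt0.
have lowE : alpha + aA < a - L * h.
  by move: low; rewrite (powR_expR_lnV _ r0) nuE AE -!expRD ltr_expR.
have h2h : h2 <= h.
  apply: (@mul_expR_le _ (d * L)) => //; first by rewrite mulr_ge0 // ltW.
  (* This [q] is minus the real level of the high-budget case. The equation of [h] becomes
     [h e^(dLh) = n / (4C) e^(q-1)], and a low budget gives [q >= 1]. *)
  rewrite h2E; set q := (a - aA - L * h) / alpha.
  have q1 : 1 <= q by rewrite ler_pdivlMr // mul1r; lra.
  have -> : h * expR (d * L * h) = n%:R / (4 * C) * expR (q - 1).
    have : h * expR ((d + alpha^-1) * L * h) * expR (- (alpha^-1 * L * h)) =
           h * expR (d * L * h) by rewrite !mulrDl expRD expRN; field; rewrite gt_eqF // expR_gt0.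
    move=> <-; rewrite hE nuE AE -!expRM.
    have -> : q - 1 = a / alpha - aA / alpha - alpha^-1 * L * h - 1 by rewrite /q; ring.
    rewrite expRN !expRB.
    by field; rewrite !gt_eqF ?expR_gt0 //; lra.
  rewrite ler_peMr //; first by rewrite divr_ge0 //; lra.
  by rewrite -[leLHS]expR0 ler_expR; lra.
apply: (@kometo_regret_biased n 0 h2 A) => //.
- exact: ltW.
- rewrite AE nuE (powR_expR_lnV _ r0) -expRD ler_expR.
  by have := ler_wpM2l (ltW L0) h2h; lra.
- by rewrite divr_ge0 ?powR_ge0 // ltW.
- rewrite expR0; apply: ordPhi => //.
  by have := PhiA 1 (lexx _); rewrite powR1 divr1.
- move=> n0; have n1 : 1 <= n%:R :> R by rewrite ler1n.
  by apply: ordPhi => //; apply: PhiA.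
by rewrite h2E expR0 mulr1 mulrC divfK // gt_eqF //; lra.
Qed.

(* [s] is [L * h] for a high budget and [a_{b,nu}] for a low one. *)
Lemma regret_b lam n B sigma beta s h : 0 < B -> 0 < sigma -> 0 < beta ->
  in_F (asm_b B sigma beta) f lam zsel fz ->
  1 <= 2 * sigma * s -> ln (B / nu) <= s -> 0 <= h -> L * h <= s ->
  4 * C * expR 1 * (2 * sigma * s) `^ beta^-1 * (h * expR (d * L * h)) <= n%:R ->
  fmax f - f (kometo_output K xr fz zsel n ch1 ch2) <=
    3 * nu / rho * rho `^ h + 2 * (B * expR (- (n%:R `^ beta) / sigma)).
Proof.
move=> B0 si0 be0 /in_F_ordered[Phi PhiA ordPhi] s1 Bs h0 hs hn.
have /andP[r0 r1] := rho01; have [_ [d0 [C1 _]]] := fS.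
have s0 : 0 < 2 * sigma * s by lra.
(* At level [q] the cost [e^q] satisfies [(e^q)^beta = 2 sigma s], so the bias is at most
   [B e^(-2s)]: one factor [e^(-s)] absorbs [B / nu], the other is at most [rho^h]. *)
set q := ln (2 * sigma * s) / beta.
have cE : (2 * sigma * s) `^ beta^-1 = expR q by rewrite /q expRM lnK.
have q0 : 0 <= q by rewrite divr_ge0 ?ln_ge0 // ltW.
have [|p /andP[qp pq]] := @exists_nat_unit_above _ q; first by lra.
have ep := expR_nat_ge1 p.
apply: (@kometo_regret_biased n p h (B * expR (- (expR p%:R `^ beta) / sigma))) => //.
- by rewrite mulr_ge0 ?expR_ge0 // ltW.
- have pb : 2 * sigma * s <= expR p%:R `^ beta.
    rewrite -expRM -[leLHS]lnK // ler_expR.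
    by have := ler_wpM2r (ltW be0) qp; rewrite /q divfK // gt_eqF.
  have Bnu : B <= nu * expR s.
    rewrite -ler_pdivrMl // mulrC -[leLHS]lnK ?ler_expR // posrE divr_gt0 //.
  apply: (@le_trans _ _ (nu * expR s * expR (- (2 * s)))).
    apply: ler_pM; rewrite ?expR_ge0 // ?(ltW B0) //.
    by rewrite ler_expR mulNr lerN2 ler_pdivlMr //; lra.
  by rewrite -mulrA -expRD (powR_expR_lnV _ r0) ler_pM2l // ler_expR; lra.
- by rewrite mulr_ge0 ?expR_ge0 // ltW.
- by apply: ordPhi => //; apply: PhiA.
- move=> n0; have n1 : 1 <= n%:R :> R by rewrite ler1n.
  by apply: ordPhi => //; apply: PhiA.
apply: le_trans hn; rewrite cE -[_ * expR 1 * expR q]mulrA -expRD addrC.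
rewrite ler_wpM2r ?mulr_ge0 ?expR_ge0 // ler_wpM2l ?ler_expR //; lra.
Qed.

(* Raises the defining equation of [h] to the power [(beta + 1) / beta]. *)
Lemma depth_b_eq (sigma beta h w : R) : 0 < sigma -> 0 < beta -> 0 <= h -> 0 <= w ->
  h * expR (beta / (beta + 1) * d * L * h) =
    w `^ (beta / (beta + 1)) * (1 / (2 * sigma * L)) `^ (1 / (beta + 1)) ->
  (2 * sigma * (L * h)) `^ beta^-1 * (h * expR (d * L * h)) = w.
Proof.
move=> si0 be0 h0 w0 hE; have L0 := ln_invr_gt0.
have sL0 : 0 < 2 * sigma * L by rewrite !mulr_gt0.
have bN0 : beta != 0 by rewrite gt_eqF.
have b1N0 : beta + 1 != 0 by rewrite gt_eqF //; lra.
have gE : (beta + 1) / beta = 1 + beta^-1 by field.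
have hhE : h * h `^ beta^-1 * expR (d * L * h) =
    w * (1 / (2 * sigma * L)) `^ beta^-1.
  have := congr1 (fun x => x `^ ((beta + 1) / beta)) hE => /=.
  rewrite powRM ?expR_ge0 // -expRM [in RHS]powRM ?powR_ge0 // -!powRrM.
  have -> : beta / (beta + 1) * ((beta + 1) / beta) = 1 by field; apply/andP.
  have -> : 1 / (beta + 1) * ((beta + 1) / beta) = beta^-1 by field; apply/andP.
  have -> : beta / (beta + 1) * d * L * h * ((beta + 1) / beta) = d * L * h.
    by field; apply/andP.
  rewrite powRr1 // gE powRD; last first.
    by apply/implyP => /eqP; have := invr_gt0 beta; rewrite be0; lra.
  by rewrite powRr1.
have -> : 2 * sigma * (L * h) = 2 * sigma * L * h by ring.
rewrite powRM ?(ltW sL0) //.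
set x := (2 * sigma * L) `^ _; set y := h `^ _ in hhE *; set z := expR _ in hhE *.
have -> : x * y * (h * z) = x * (h * y * z) by ring.
rewrite hhE mulrCA -powRM ?(ltW sL0) //; last by rewrite divr_ge0 // ltW.
by rewrite mul1r divff ?gt_eqF // powR1 mulr1.
Qed.

(** Rounding [ln a] up gives a level of cost between [a] and [a e], where the bias vanishes. If
    [h >= 1] then also [n >= a], so the final comparison is exact and only the loss of the cell
    remains. *)
Lemma regret_c lam n a h : 1 <= a ->
  in_F (asm_c a) f lam zsel fz -> 0 <= h ->
  h * expR (d * L * h) = n%:R / (4 * C * a * expR 1) ->
  fmax f - f (kometo_output K xr fz zsel n ch1 ch2) <= nu / rho * rho `^ h.
Proof.
move=> a1 /in_F_ordered[Phi PhiA ordPhi] h0 hE.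
have /andP[r0 r1] := rho01; have [_ [d0 [C1 _]]] := fS.
have rh0 : 0 <= rho `^ h := powR_ge0 _ _.
have L0 := ln_invr_gt0; have e1 : 1 <= expR 1 :> R := expR_nat_ge1 1.
have [h1|h1] := ltP h 1.
  apply: le_trans (regret_le_nu _) _.
  rewrite -mulrA ler_peMr ?(ltW nu0) // ler_pdivlMl // mulr1.
  by rewrite -{1}(powRr1 (ltW r0)) ler_powR_anti // ltW.
have D0 : 0 < 4 * C * a * expR 1 by rewrite !mulr_gt0 //; lra.
have nE : n%:R = 4 * C * a * expR 1 * (h * expR (d * L * h)).
  by rewrite hE mulrC divfK // gt_eqF.
have [|p /andP[qp pq]] := @exists_nat_unit_above _ (ln a).
  by have := ln_ge0 a1; lra.
have a0 : 0 < a by lra.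
have ap : a <= expR p%:R by rewrite -[leLHS]lnK // ler_expR.
have pa : expR p%:R <= a * expR 1.
  by rewrite -[X in X * _]lnK // -expRD ler_expR.
have ord0 c : a <= c -> ordered_upto f (fz (zsel c)) 0.
  by move=> ac; apply: ordPhi; rewrite ?PhiA //; lra.
have hx : 1 <= h * expR (d * L * h).
  rewrite -[leLHS]mulr1; apply: ler_pM => //.
  by rewrite -expR0 ler_expR !mulr_ge0 // ltW.
have an : a <= n%:R.
  by rewrite nE; set y := h * _ in hx *; nra.
have powE : rho `^ (- (d * h)) = expR (d * L * h).
  by rewrite (powR_expR_lnV _ r0); congr expR; ring.
have := @kometo_regret n p h 0 0 h1 (lexx _) _ (ord0 _ ap) (ord0 _ an).
rewrite powE !mulr0 !addr0 => bd; apply: le_trans (bd _ _) _.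
- by rewrite mulr_ge0 // ltW.
- rewrite nE; apply: ler_wpM2r; first by lra.
  by rewrite -[leRHS]mulrA; apply: ler_wpM2l => //; lra.
by rewrite ler_wpM2r // ler_peMr ?(ltW nu0) // invf_ge1 // ltW.
Qed.

End Regret.

Theorem theorem3 (R : realType) (X : Type) (K : nat)
  (P : nat -> nat -> set X) (xr : nat -> nat -> X)
  (nu rho d C Lam : R) (f : X -> R) (lam : R -> \bar R)
  (fz : R -> X -> R) (zsel : R -> R)
  (ch1 : seq (nat * nat) -> (nat * nat -> R) -> nat * nat)
  (ch2 : seq nat -> (nat -> R) -> nat) :
  (2 <= K)%N -> hier_partition K P xr ->
  0 < nu -> 0 < rho < 1 -> 0 <= d <= dmax K rho -> Cmin K rho d <= C ->
  1 <= Lam -> in_S K P nu rho d C f ->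
  (forall z, 0 <= z <= 1 -> (0 <= lam z)%E) ->
  argmax_spec ch1 -> argmax_spec ch2 ->
  let Lt : R := (Ltilde K Lam)%:R in
  let L : R := ln rho^-1 in
  let e : R := expR 1 in
  let r : R := fmax f - f (kometo_output K xr fz zsel (Ltilde K Lam) ch1 ch2) in
  (* Assumption (a) *)
  (forall A alpha : R, 0 < A -> 0 < alpha ->
     in_F (asm_a A alpha) f lam zsel fz ->
     let h1 := LambertW (Lt * nu `^ alpha^-1 * (d + alpha^-1) * L
                           / (4 * C * e * A `^ alpha^-1)) / ((d + alpha^-1) * L) in
     let h2 := if d == 0 then Lt / (4 * C)
               else LambertW (Lt * d * L / (4 * C)) / (d * L) in
     (nu * rho `^ h1 <= expR alpha * A ->
        r <= 3 * nu / rho * rho `^ h1 + 2 * A / Lt `^ alpha) /\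
     (nu * rho `^ h1 > expR alpha * A ->
        r <= 3 * nu / rho * rho `^ h2 + 2 * A / Lt `^ alpha)) /\
  (* Assumption (b) *)
  (forall B sigma beta : R, 0 < B -> 0 < sigma -> 0 < beta ->
     in_F (asm_b B sigma beta) f lam zsel fz ->
     let abn := Num.max (1 / (2 * sigma)) (ln (B / nu)) in
     let base := (Lt / (4 * C * e)) `^ (beta / (beta + 1))
                 * (1 / (2 * sigma * L)) `^ (1 / (beta + 1)) in
     let h1 := if d == 0 then base
               else (beta + 1) / (beta * d * L)
                    * LambertW (beta / (beta + 1) * d * L * base) in
     let D := 4 * C * e * (2 * sigma * abn) `^ beta^-1 in
     let h2 := if d == 0 then Lt / D
               else LambertW (Lt * d * L / D) / (d * L) in
     (h1 >= abn / L ->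
        r <= 3 * nu / rho * rho `^ h1 + 2 * B * expR (- (Lt `^ beta) / sigma)) /\
     (h1 < abn / L ->
        r <= 3 * nu / rho * rho `^ h2 + 2 * B * expR (- (Lt `^ beta) / sigma))) /\
  (* Assumption (c) *)
  (forall a : R, 1 <= a ->
     in_F (asm_c a) f lam zsel fz ->
     let h := if d == 0 then Lt / (4 * C * a * e)
              else LambertW (Lt * d * L / (4 * C * a * e)) / (d * L) in
     r <= nu / rho * rho `^ h).

Proof.
move=> K2 partP nu0 rho01 _ _ _ fS _ ch1P ch2P.
set n := Ltilde K Lam => Lt L e r.
have [_ [d0 [C1 _]]] := fS; have L0 : 0 < L := ln_invr_gt0 rho01.
have Lt0 : 0 <= Lt by rewrite ler0n.
have e0 : 0 < e := expR_gt0 _.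
have C4 : 0 < 4 * C by lra.
split; [|split].
- move=> A alpha A0 al0 FA h1 h2.
  have ial0 : 0 < alpha^-1 by rewrite invr_gt0.
  have k0 : 0 < (d + alpha^-1) * L by rewrite mulr_gt0 // ltr_wpDl.
  have [h10 h1E] : 0 <= h1 /\ h1 * expR ((d + alpha^-1) * L * h1) =
      Lt * nu `^ alpha^-1 / (4 * C * e * A `^ alpha^-1).
    have := @LambertW_eq _ ((d + alpha^-1) * L)
      (Lt * nu `^ alpha^-1 / (4 * C * e * A `^ alpha^-1)) (ltW k0).
    rewrite (gt_eqF k0) /h1.
    have <- : Lt * nu `^ alpha^-1 * (d + alpha^-1) * L / (4 * C * e * A `^ alpha^-1) =
      (d + alpha^-1) * L * (Lt * nu `^ alpha^-1 / (4 * C * e * A `^ alpha^-1)) by ring.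
    by apply; rewrite divr_ge0 ?mulr_ge0 ?powR_ge0 ?(ltW e0) ?(ltW C4) //; lra.
  have [h20 h2E] : 0 <= h2 /\ h2 * expR (d * L * h2) = Lt / (4 * C).
    exact: (depth_eq rho01 fS).
  rewrite -[2 * A / _]mulrA; split.
    exact: (regret_a_high K2 partP nu0 rho01 fS ch1P ch2P A0 al0 FA).
  by move=> low; exact: (regret_a_low K2 partP nu0 rho01 fS ch1P ch2P A0 al0 FA h10).
- move=> B sigma beta B0 si0 be0 FB abn base h1 D h2.
  have b10 : 0 < beta + 1 by lra.
  have s1 : 1 <= 2 * sigma * abn.
    by rewrite -ler_pdivrMl ?mulr_gt0 // mulr1 -[leLHS]mul1r le_max lexx.
  have Bs : ln (B / nu) <= abn by rewrite le_max lexx orbT.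
  have base0 : 0 <= base by rewrite mulr_ge0 ?powR_ge0.
  have w0 : 0 <= Lt / (4 * C * e) by rewrite divr_ge0 // mulr_ge0 // ltW.
  have k0 : 0 <= beta / (beta + 1) * d * L by rewrite !mulr_ge0 ?invr_ge0 // ltW.
  have [h10 h1E] : 0 <= h1 /\ h1 * expR (beta / (beta + 1) * d * L * h1) = base.
    have := LambertW_eq k0 base0.
    rewrite !mulf_eq0 invr_eq0 (gt_eqF L0) (gt_eqF be0) (gt_eqF b10) /= orbF /h1.
    case: (eqVneq d 0) => // dN0.
    suff -> : (beta + 1) / (beta * d * L) = (beta / (beta + 1) * d * L)^-1.
      by rewrite [_^-1 * _]mulrC.
    by field; rewrite dN0 !gt_eqF.
  have h1W := depth_b_eq rho01 si0 be0 h10 w0 h1E.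
  have c0 : 0 < (2 * sigma * abn) `^ beta^-1 by rewrite powR_gt0 //; lra.
  have D0 : 0 < D by rewrite !mulr_gt0 //; lra.
  have [h20 h2E] : 0 <= h2 /\ h2 * expR (d * L * h2) = Lt / D.
    exact: (depth_eq rho01 fS).
  have C4e : 4 * C * e != 0 by rewrite gt_eqF // mulr_gt0.
  rewrite -[2 * B * _]mulrA; split.
    (* A high budget takes [s = L * h1], for which [h1W] is the budget condition with equality. *)
    rewrite ler_pdivrMr // [h1 * L]mulrC => high.
    apply: (regret_b K2 partP nu0 rho01 fS ch1P ch2P B0 si0 be0 FB _ _ h10 (lexx _)).
    + by apply: le_trans s1 _; rewrite ler_wpM2l // mulr_ge0 // ltW.
    + exact: le_trans high.
    + by rewrite -mulrA h1W mulrC divfK.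
  rewrite ltr_pdivlMr // [h1 * L]mulrC => low.
  apply: (regret_b K2 partP nu0 rho01 fS ch1P ch2P B0 si0 be0 FB s1 Bs h20).
    (* It is enough that [h2 <= h1]. Both equations divide the same budget, by
       [(2 sigma abn)^(1/beta)] for [h2] and by [(2 sigma L h1)^(1/beta)] for [h1]; the former is
       larger since [abn > L * h1]. *)
    apply: le_trans (ltW low); rewrite ler_pM2l //.
    apply: (@mul_expR_le _ (d * L)) => //; first by rewrite mulr_ge0 // ltW.
    rewrite h2E /D invfM mulrA ler_pdivrMr // -h1W mulrC ler_wpM2l //.
      by rewrite mulr_ge0 ?expR_ge0.
    apply: ge0_ler_powR; rewrite ?nnegrE ?invr_ge0 ?(ltW be0) //.
    + by rewrite !mulr_ge0 // ltW.
    + by lra.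
    + by rewrite ler_wpM2l ?(ltW low) // mulr_ge0 // ltW.
  by rewrite h2E mulrC divfK // gt_eqF.
- move=> a a1 FC /=; set h := (X in rho `^ X).
  have [h0 hE] : 0 <= h /\ h * expR (d * L * h) = Lt / (4 * C * a * e).
    by apply: (depth_eq rho01 fS) => //; rewrite !mulr_gt0 //; lra.
  exact: (regret_c K2 partP nu0 rho01 fS ch1P ch2P a1 FC h0).
Qed.
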